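(* Let $(G,S)$ be a right-angled Artin group. For all $w\in G$, the preorder $\preceq_w$ on $G$ defined by $x\preceq_wy\iff y\in[x,wy]$ determines a quasidirection $\bullet_w$ on $G$; that is, there is a unique quasidirection $\bullet_w$ on the median set $G$ such that for all $x,y\in G$, $x\preceq_wy\iff y\bullet_wx=y$.
   Context: $(G,S)$ is a right-angled Artin group: $S\subseteq G$ is a (possibly infinite) generating set of the group $G$ with $S\cap S^{-1}=\emptyset$, and $G$ has the presentation $\langle S\,;\,[s,t]=1$ for those $s\neq t$ in $S$ with $st=ts$ in $G\rangle$. Let $l$ be the word length on $G$ with respect to $S\cup S^{-1}$. Write $x\subset y$ iff $l(x)+l(x^{-1}y)=l(y)$; this is a partial order with least element $1$, in which any two elements have a greatest lower bound $x\cap y$. Put $[x,y]=\{z\in G: x^{-1}z\subset x^{-1}y\}$ and $Y(x,y,z)=x(x^{-1}y\cap x^{-1}z)$, the unique element of $[x,y]\cap[y,z]\cap[z,x]$; the ternary operation $Y$ makes $G$ a median set. A quasidirection on a median set $(X,Y)$ is a binary operation $\bullet$ on $X$ such that: (i) $\bullet$ is associative and idempotent ($x\bullet x=x$); (ii) $a\bullet b\bullet c=a\bullet c\bullet b$ for all $a,b,c\in X$; (iii) $a\bullet Y(x,y,z)=Y(a\bullet x,\,y,\,a\bullet z)$ for all $a,x,y,z\in X$; (iv) $Y(x,y,z)\bullet x=Y(x,y,z\bullet x)$ for all $x,y,z\in X$. *)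

(* Defs.v *)
From mathcomp Require Import all_boot.
From mathcomp Require Import boolp classical_sets.

Set Implicit Arguments.
Unset Strict Implicit.
Unset Printing Implicit Defensive.

Local Open Scope classical_set_scope.
Local Open Scope group_scope.

(* Group words on the alphabet [A]: the letter [(a, false)] stands for [a],
   the letter [(a, true)] for the formal inverse of [a]. *)
Definition word (A : Type) : Type := seq (A * bool).

Definition word_val (G : groupType) (A : Type) (f : A -> G) (u : word A) : G :=
  \prod_(a <- u) (if a.2 then (f a.1)^-1 else f a.1).

(* Equality in the group < A ; r = 1 for r in R >. *)
Inductive pres_eq (A : Type) (R : set (word A)) : word A -> word A -> Prop :=
| pres_eq_refl u : pres_eq R u u
| pres_eq_sym u v : pres_eq R u v -> pres_eq R v u
| pres_eq_trans u v w : pres_eq R u v -> pres_eq R v w -> pres_eq R u w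
| pres_eq_cancel u v a b :
    pres_eq R (u ++ [:: (a, b); (a, ~~ b)] ++ v) (u ++ v)
| pres_eq_relator u v r : R r -> pres_eq R (u ++ r ++ v) (u ++ v).

(* [G] is presented by < A ; r = 1 for r in R >, where each generator [a] of
   the presentation stands for the element [f a] of [G]. *)
Definition has_presentation (G : groupType) (A : Type) (f : A -> G)
    (R : set (word A)) : Prop :=
  (forall x : G, exists u, word_val f u = x) /\
  (forall u v, word_val f u = word_val f v <-> pres_eq R u v).

Definition inv_set (G : groupType) (S : set G) : set G := [set s^-1 | s in S].

Definition comm_word (A : Type) (s t : A) : word A :=
  [:: (s, true); (t, true); (s, false); (t, false)].

Definition raag_relators (G : groupType) (S : set G) : set (word S) :=
  [set r | exists s t : S,
     [/\ val s <> val t, val s * val t = val t * val s & r = comm_word s t]].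
Arguments raag_relators {G} S _.

Definition raag (G : groupType) (S : set G) : Prop :=
  S `&` inv_set S = set0 /\
  has_presentation (fun s : S => val s) (raag_relators S).

Section Geometry.
Variables (G : groupType) (S : set G).

Definition expressible (x : G) (n : nat) : Prop :=
  exists u : seq G, [/\ size u = n,
    forall a, a \in u -> (S `|` inv_set S) a & \prod_(a <- u) a = x].

(* The least [n] such that [x] is a product of [n] elements of [S] and their
   inverses (it exists as soon as [S] generates [G]). *)
Definition len (x : G) : nat :=
  xget 0%N [set n | expressible x n /\ forall m, expressible x m -> (n <= m)%N].

Definition gle (x y : G) : Prop := (len x + len (x^-1 * y))%N = len y.

Definition is_glb (x y z : G) : Prop :=
  [/\ gle z x, gle z y & forall u, gle u x -> gle u y -> gle u z].

(* The default value [1] is irrelevant in a right-angled Artin group, where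
   greatest lower bounds exist. *)
Definition gmeet (x y : G) : G := xget 1 [set z | is_glb x y z].

Definition interval (x y : G) : set G := [set z | gle (x^-1 * z) (x^-1 * y)].

Definition median (x y z : G) : G := x * gmeet (x^-1 * y) (x^-1 * z).

Definition preceq (w x y : G) : Prop := interval x (w * y) y.

End Geometry.

Definition quasidirection (X : Type) (Y : X -> X -> X -> X)
    (op : X -> X -> X) : Prop :=
  [/\ associative op /\ idempotent_op op,
      forall a b c, op (op a b) c = op (op a c) b,
      forall a x y z, op a (Y x y z) = Y (op a x) y (op a z)
    & forall x y z, op (Y x y z) x = Y x y (op z x)].

(* Main.v *)
Require Import Defs.
From mathcomp Require Import all_boot zify.
From mathcomp Require Import boolp classical_sets.

(* A normal form argument in the partially commutative monoid solves the word
   problem and yields the cube condition: two distinct initial letters of x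
   commute, and their product is again initial in x.  Hence the sets
   {x | s is initial in g^-1 x}, called halfspaces, are convex, separate points,
   and an edge of the Cayley graph crosses only one hyperplane; so intervals and
   medians can be computed halfspace by halfspace, the median by majority.

   A halfspace and its translate by w have the same label, hence are nested.
   By cyclic reduction, w stabilizes every halfspace that one of its nontrivial
   powers stabilizes.  It follows that every halfspace h is either invariant
   under w, or contains w^n a for all large n whatever a is, or avoids w^n a for
   all large n whatever a is.  The operation sends (a, b) to the median of a, b
   and w^n a for n large; its membership in h is that of a, the disjunction, or
   the conjunction of those of a and b in the three cases, so that the axioms
   reduce to Boolean identities.  Uniqueness is a computation with the axioms. *)

Set Implicit Arguments.
Unset Strict Implicit.
Unset Printing Implicit Defensive.

Local Open Scope group_scope.

(* The group operations occur through several convertible inheritance paths,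
   which [lia] would treat as distinct atoms. *)
Ltac len_lia :=
  repeat match goal with H : context [Defs.len] |- _ => move: H end;
  repeat match goal with |- context [Defs.len ?T ?x] =>
    let n := fresh "n" in move: (Defs.len T x) => n end;
  lia.

(** * Reduced traces *)

Section Traces.
Variable G : groupType.
Implicit Types (a b c : G) (u v w p : seq G).

(** Letters are elements of [G] here, not symbols, so [a] and [a^-1] commute in [G]; they still
    count as dependent, since cancellation is left to [red] and [push]. *)
Definition ind a b := [&& a * b == b * a, a != b & a != b^-1].

Lemma ind_sym a b : ind a b = ind b a.
Proof.
by rewrite /ind eq_sym [a == b]eq_sym -eqg_invLR [a^-1 == b]eq_sym.
Qed.

Lemma indxx a : ind a a = false.
Proof. by rewrite /ind !eqxx. Qed.

Lemma indxV a : ind a a^-1 = false.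
Proof. by rewrite /ind invgK eqxx /= !andbF. Qed.

Lemma ind_comm a b : ind a b -> a * b = b * a.
Proof. by case/and3P=> /eqP. Qed.

Lemma indVr a b : ind a b^-1 = ind a b.
Proof.
have e : (a * b^-1 == b^-1 * a) = (a * b == b * a).
  by rewrite divg_eq -mulgA -[RHS](inj_eq (mulgI b^-1)) mulKg eq_sym.
by rewrite /ind invgK e [(a != b^-1) && _]andbC.
Qed.

Lemma indVl a b : ind a^-1 b = ind a b.
Proof. by rewrite ind_sym indVr ind_sym. Qed.

(* Two words represent the same element of the partially commutative monoid iff
   their projections to all pairs of dependent letters agree; the pairs [a, a]
   compare multiplicities. *)
Definition teq u v :=
  forall a b, ~~ ind a b -> filter (pred2 a b) u = filter (pred2 a b) v.

Lemma teq_refl u : teq u u. Proof. by []. Qed.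

Lemma teq_sym u v : teq u v -> teq v u.
Proof. by move=> h a b d; rewrite h. Qed.

Lemma teq_trans v u w : teq u v -> teq v w -> teq u w.
Proof. by move=> h k a b d; rewrite h ?k. Qed.

Lemma teq_cons c u v : teq u v -> teq (c :: u) (c :: v).
Proof. by move=> h a b d /=; rewrite h. Qed.

Lemma teq_consI c u v : teq (c :: u) (c :: v) -> teq u v.
Proof. by move=> h a b /h /=; case: ifP => // _ []. Qed.

Lemma teq_swap a b u : ind a b -> teq (a :: b :: u) (b :: a :: u).
Proof.
move=> i x y /negP d /=; case: ifP => [ha|_]; case: ifP => [hb|_] //; case: d.
case/pred2P: ha hb i => ->; case/pred2P => -> //; rewrite ?indxx //.
by rewrite ind_sym.
Qed.

Lemma teq_perm u v : teq u v -> perm_eq u v.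
Proof.
move=> h; apply/allP => a _ /=; apply/eqP.
have e w : count_mem a w = size (filter (pred2 a a) w).
  by rewrite size_filter; apply: eq_count => x /=; rewrite orbb.
by rewrite !e h // indxx.
Qed.

Lemma teq_size u v : teq u v -> size u = size v.
Proof. by move/teq_perm/perm_size. Qed.

Fixpoint front c u :=
  if u is a :: v then (a == c) || ind c a && front c v else false.

Lemma front_cat c u v : front c (u ++ v) = front c u || all (ind c) u && front c v.
Proof.
elim: u => //= a u ->; case: (a =P c) => //= _.
by rewrite andb_orr andbA.
Qed.

Lemma frontE c u : front c u -> teq u (c :: rem c u).
Proof.
elim: u => //= a u IH; case: (a =P c) => [-> _|_ /= /andP[i f]] //.
by apply: teq_trans (teq_cons _ (IH f)) _; apply: teq_swap; rewrite ind_sym.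
Qed.

Lemma front_teq c u v : teq u (c :: v) -> front c u.
Proof.
(* A letter dependent on [c] and placed ahead of the first [c] would lead the projection onto that
   pair in place of [c]. *)
have Q w : (forall b, ~~ ind c b -> ohead (filter (pred2 c b) w) = Some c) ->
    front c w.
  elim: w => [|a w IH] /= h; first by have := h c; rewrite indxx => /(_ isT).
  case: (a =P c) => //= ac; apply/andP; split.
    by apply: contraT => /h; rewrite eqxx orbT => -[].
  apply: IH => b d; have := h b d; case: (a =P b) => [ab|_ /=].
    by rewrite orbT => -[].
  by case: eqP.
by move=> h; apply: Q => b d; rewrite h //= eqxx.
Qed.

Lemma eq_front c u v : teq u v -> front c u = front c v.
Proof.
move=> h; apply/idP/idP => /frontE f; apply: front_teq.
  exact: teq_trans (teq_sym h) f.
exact: teq_trans h f.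
Qed.

Lemma front_swap a b u : ind a b -> front a (b :: u) = front a u.
Proof. by move=> i /=; rewrite i; case: eqP => // e; rewrite e indxx in i. Qed.

Lemma teq_rem c u v : front c u -> teq u v -> teq (rem c u) (rem c v).
Proof.
move=> f h; apply: (@teq_consI c); apply: teq_trans (teq_sym (frontE f)) _.
by rewrite (eq_front c h) in f; apply: teq_trans h (frontE f).
Qed.

Lemma teq_cat_front c p v : all (ind c) p -> teq (p ++ c :: v) (c :: p ++ v).
Proof.
elim: p => //= a p IH /andP[i /IH h].
by apply: teq_trans (teq_cons a h) _; apply: teq_swap; rewrite ind_sym.
Qed.

Lemma frontE_cat c p v : front c p -> teq (p ++ v) (c :: rem c p ++ v).
Proof.
elim: p => //= a p IH; case: (a =P c) => [-> _|_ /= /andP[i f]] //.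
by apply: teq_trans (teq_cons _ (IH f)) _; apply: teq_swap; rewrite ind_sym.
Qed.

Definition red u := forall p a v, ~ teq u (p ++ a :: a^-1 :: v).

Lemma eq_red u v : teq u v -> red u -> red v.
Proof. by move=> h r p a x /(teq_trans h)/r. Qed.

Lemma red_nil : red [::].
Proof. by move=> p a v /teq_size; rewrite size_cat /= addnS. Qed.

Lemma red_behead c u : red (c :: u) -> red u.
Proof. by move=> r p b v h; apply: (r (c :: p) b v); apply: teq_cons. Qed.

Lemma red_rem c u : front c u -> red u -> red (rem c u).
Proof. by move=> f /(eq_red (frontE f))/red_behead. Qed.

(** Suppose a word equivalent to [c :: u] contains a cancelling pair; there [c] can be moved to the
    front. If this [c] lies before or after the pair, removing it leaves a cancelling pair in [u].
    If it is the first member, [c^-1] is initial in [u]. It cannot be the second, having to pass its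
    own inverse. *)
Lemma red_cons c u : ~~ front c^-1 u -> red u -> red (c :: u).
Proof.
move=> nf r p b v h; have : front c (p ++ b :: b^-1 :: v).
  by apply: front_teq; apply: teq_sym h.
rewrite front_cat => /orP[f|/andP[ip /=]].
  apply: (r (rem c p) b v); apply: (@teq_consI c); apply: teq_trans h _.
  exact: frontE_cat.
case: (b =P c) => [bc _|_ /= /andP[i]].
  subst b; move/negP: nf; apply; apply: (@front_teq _ _ (p ++ v)).
  apply: teq_trans (_ : teq u (p ++ c^-1 :: v)) _.
    apply: (@teq_consI c); apply: teq_trans h _; exact: teq_cat_front.
  by apply: teq_cat_front; apply: sub_all ip => x; rewrite indVl.
rewrite (indVr c b) i andTb => /orP[/eqP bc|f].
  by rewrite -bc ind_sym indxV in i.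
apply: (r p b (rem c v)); apply: (@teq_consI c); apply: teq_trans h _.
have fc : front c [:: b, b^-1 & v] by rewrite !front_swap ?indVr.
have e : teq [:: b, b^-1 & v] [:: c, b, b^-1 & rem c v].
  apply: teq_trans (_ : teq _ [:: b, b^-1, c & rem c v]) _.
    by do 2!apply: teq_cons; apply: frontE.
  apply: teq_trans (_ : teq _ [:: b, c, b^-1 & rem c v]) _.
    by apply: teq_cons; apply: teq_swap; rewrite ind_sym indVr.
  by apply: teq_swap; rewrite ind_sym.
apply: teq_trans (_ : teq _ (p ++ [:: c, b, b^-1 & rem c v])) _.
  by elim: (p) => //= x q; apply: teq_cons.
exact: teq_cat_front.
Qed.

(** * Normal forms *)

Definition push a u := if front a^-1 u then rem a^-1 u else a :: u.

Lemma eq_push a u v : teq u v -> teq (push a u) (push a v).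
Proof.
move=> h; rewrite /push -(eq_front _ h); case: ifP => f; first exact: teq_rem.
exact: teq_cons.
Qed.

Lemma red_push a u : red u -> red (push a u).
Proof.
by rewrite /push; case: ifP => f r; [apply: red_rem|apply: red_cons; rewrite ?f].
Qed.

(** With [pushC], this shows that [push] respects the defining relations, so that the presented
    group acts on reduced words up to [teq]: van der Waerden's argument for normal forms. *)
Lemma pushK a u : red u -> teq (push a (push a^-1 u)) u.
Proof.
move=> r; rewrite {2}/push invgK; case: ifP => [f|_]; last first.
  by rewrite /push /= eqxx.
have e := frontE f; rewrite /push; case: ifP => [g|_]; last exact: teq_sym.
exfalso; apply: (r [::] a (rem a^-1 (rem a u))); apply: teq_trans e _.
by apply: teq_cons; apply: frontE.
Qed.

Lemma pushC a b u : ind a b -> teq (push a (push b u)) (push b (push a u)).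
Proof.
move=> i; have i' : ind a^-1 b^-1 by rewrite indVl indVr.
have j : ind b a by rewrite ind_sym.
have j' : ind b^-1 a^-1 by rewrite ind_sym.
have fr x y : ind x y -> front y u -> front x (rem y u) = front x u.
  by move=> ixy /frontE e; rewrite (eq_front x e) front_swap.
have remc x y : ind x y -> front x u -> teq (rem x (y :: u)) (y :: rem x u).
  move=> ixy f; apply: (@teq_consI x); apply: teq_trans (teq_sym (frontE _)) _.
    by rewrite front_swap.
  apply: teq_trans (teq_cons y (frontE f)) _; apply: teq_swap.
  by rewrite ind_sym.
rewrite /push; case: (boolP (front b^-1 u)) => fb; case: (boolP (front a^-1 u)) => fa.
- rewrite !fr // fa fb.
  apply: (@teq_consI a^-1); apply: (@teq_consI b^-1).
  apply: teq_trans (_ : teq _ u) _.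
    apply: teq_trans (teq_cons _ (teq_sym (frontE _))) (teq_sym (frontE fb)).
    by rewrite fr.
  apply: teq_trans (_ : teq u (a^-1 :: b^-1 :: rem b^-1 (rem a^-1 u))) _.
    apply: teq_trans (frontE fa) _; apply: teq_cons; apply: frontE.
    by rewrite fr.
  exact: teq_swap.
- rewrite fr // (negbTE fa) front_swap ?fb; last by rewrite indVl.
  by apply: teq_sym; apply: remc; rewrite ?indVl.
- rewrite front_swap ?indVl // fa fr // (negbTE fb); apply: remc => //.
  by rewrite indVl.
by rewrite !front_swap ?indVl // (negbTE fa) (negbTE fb); apply: teq_swap.
Qed.

Definition nf u := foldr push [::] u.

Lemma nf_cat u v : nf (u ++ v) = foldr push (nf v) u.
Proof. exact: foldr_cat. Qed.

Lemma red_nf u : red (nf u).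
Proof. by elim: u => [|a u IH]; [apply: red_nil|apply: red_push]. Qed.

Lemma nf_catl p u v : teq (nf u) (nf v) -> teq (nf (p ++ u)) (nf (p ++ v)).
Proof. by move=> h; rewrite !nf_cat; elim: p => //= a p /(eq_push a). Qed.

Lemma size_push_odd a u : odd (size (push a u)) = ~~ odd (size u).
Proof.
rewrite /push; case: ifP => //= /frontE/teq_size /= ->.
by rewrite negbK.
Qed.

Lemma odd_size_nf u : odd (size (nf u)) = odd (size u).
Proof. by elim: u => //= a u IH; rewrite size_push_odd IH. Qed.

Lemma size_push a u : size (push a u) <= (size u).+1 ?= iff ~~ front a^-1 u.
Proof.
rewrite /push; case: ifP => [/frontE/teq_size /= ->|_] /=; exact/leqifP.
Qed.

Lemma size_nf u : size (nf u) <= size u.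
Proof.
elim: u => //= a u IH; apply: leq_trans (size_push _ _) _.
by rewrite ltnS.
Qed.

Lemma size_nf_eq u : size (nf u) = size u -> nf u = u.
Proof.
elim: u => //= a u IH h; have := size_push a (nf u).
have le := size_nf u; rewrite h => -[h1 h2].
have e : size (nf u) = size u by apply/eqP; rewrite eqn_leq le.
by move: h2; rewrite /push e eqxx; case: ifP => // _ _; rewrite IH.
Qed.

Lemma sub_nf u : {subset nf u <= u}.
Proof.
elim: u => //= a u IH x; rewrite /push; case: ifP => _.
  by move/mem_rem/IH => h; rewrite inE h orbT.
by rewrite !inE => /orP[->//|/IH ->]; rewrite orbT.
Qed.

Lemma prod_front c u : front c u ->
  \prod_(a <- u) a = c * \prod_(a <- rem c u) a.
Proof.
elim: u => //= a u IH; case: (a =P c) => [-> _|_ /= /andP[i f]].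
  by rewrite big_cons.
by rewrite !big_cons IH // !mulgA (ind_comm i).
Qed.

Lemma prod_nf u : \prod_(a <- nf u) a = \prod_(a <- u) a.
Proof.
elim: u => //= a u IH; rewrite big_cons -IH /push; case: ifP => f.
  by rewrite (prod_front f) mulVKg.
by rewrite big_cons.
Qed.

End Traces.

(** * Word length *)

Section Length.
Variables (G : groupType) (S : set G).
Hypothesis hGS : raag S.
Implicit Types (a b c s t : G) (u v w p : seq G) (x y z : G).

Definition letter a : Prop := (S `|` inv_set S)%classic a.

Lemma letterV a : letter a -> letter a^-1.
Proof. by case=> [Sa|[b Sb <-]]; [right; exists a|left; rewrite invgK]. Qed.

Lemma S_disjV s : S s -> S s^-1 -> False.
Proof.
move=> Ss SVs; have [d _] := hGS.
have : (S `&` inv_set S)%classic s by split=> //; exists s^-1; rewrite ?invgK.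
by rewrite d.
Qed.

Lemma letter_neqV a : letter a -> a != a^-1.
Proof.
move=> la; apply/eqP => e; case: la => [Sa|[b Sb ba]].
  by apply: (S_disjV Sa); rewrite -e.
by apply: (S_disjV Sb); rewrite ba e -ba invgK.
Qed.

Definition lval (l : S * bool) : G := if l.2 then (val l.1)^-1 else val l.1.

Lemma letter_lval l : letter (lval l).
Proof.
case: l => s [] /=; have := set_mem (valP s); first by right; exists (val s).
by left.
Qed.

Definition letters u := forall a, a \in u -> letter a.

Lemma letters_lval u : letters u -> exists v : word S, u = map lval v.
Proof.
elim: u => [_|a u IH h]; first by exists [::].
have [|v ->] := IH; first by move=> b bu; apply: h; rewrite inE bu orbT.
have [Sa|[b Sb <-]] := h a (mem_head _ _).
  by exists ((exist _ a (mem_set Sa), false) :: v).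
by exists ((exist _ b (mem_set Sb), true) :: v).
Qed.

Lemma word_valE (v : word S) :
  word_val (fun s : S => val s) v = \prod_(a <- map lval v) a.
Proof. by rewrite big_map. Qed.

Lemma teq_nf_pres (u v : word S) : pres_eq (raag_relators S) u v ->
  teq (nf (map lval u)) (nf (map lval v)).
Proof.
elim=> {u v} [u|u v _|u v w _ h _ k|u v a b|u v r [s [t [st cst ->]]]].
- exact: teq_refl.
- exact: teq_sym.
- exact: teq_trans h k.
- rewrite !map_cat; apply: nf_catl => /=.
  have -> : lval (a, ~~ b) = (lval (a, b))^-1 by case: b; rewrite ?invgK.
  exact/pushK/red_nf.
rewrite !map_cat; apply: nf_catl => /=; rewrite /lval /=.
set w := nf _; have rw : red w by apply: red_nf.
have ist : ind (val s) (val t).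
  rewrite /ind cst eqxx /=; apply/andP; split; apply/eqP => // e.
  by apply: (S_disjV (set_mem (valP t))); rewrite -e; apply/set_mem/valP.
(* Exchanging the two middle letters of the relator leaves two adjacent cancelling pairs. *)
apply: teq_trans (_ : teq _ (push (val s)^-1 (push (val s)
  (push (val t)^-1 (push (val t) w))))) _.
  by apply/eq_push/pushC; rewrite indVl ind_sym.
have := @pushK _ (val s)^-1; rewrite invgK => h.
apply: teq_trans (h _ _) _; first by do 2!apply: red_push.
by have := @pushK _ (val t)^-1; rewrite invgK; apply.
Qed.

Lemma teq_nf u v : letters u -> letters v ->
  \prod_(a <- u) a = \prod_(a <- v) a -> teq (nf u) (nf v).
Proof.
move=> /letters_lval[u' ->] /letters_lval[v' ->]; rewrite -!word_valE => h.
by apply: teq_nf_pres; apply/(hGS.2.2).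
Qed.

Lemma lenP x : expressible S x (len S x) /\
  forall n, expressible S x n -> len S x <= n.
Proof.
rewrite /len; case: xgetP => [n _ []//|/(_ _) none].
have [u ux] := hGS.2.1 x.
have ex : exists n, `[< expressible S x n >].
  exists (size (map lval u)); apply/asboolP; exists (map lval u).
  split=> //; last by rewrite -word_valE.
  by move=> a /mapP[l _ ->]; apply: letter_lval.
exfalso; case: (ex_minnP ex) => n /asboolP en mn.
by apply: (none n); split=> // m em; apply: mn; apply/asboolP.
Qed.

Definition geod x u := [/\ letters u, \prod_(a <- u) a = x & size u = len S x].

Lemma geod_exists x : exists u, geod x u.
Proof. by have [[u [su lu pu]] _] := lenP x; exists u. Qed.

Lemma len_le u : letters u -> len S (\prod_(a <- u) a) <= size u.
Proof. by move=> lu; apply: (lenP _).2; exists u. Qed.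

Lemma letters_nf u : letters u -> letters (nf u).
Proof. by move=> lu a /sub_nf/lu. Qed.

(** A geodesic word cannot shrink under [nf], hence is its own normal form, and normal forms are
    unique up to [teq]. *)
Lemma geod_teq x u v : geod x u -> geod x v -> teq u v.
Proof.
have nfE w : geod x w -> nf w = w.
  case=> lw pw sw; apply: size_nf_eq; apply/eqP; rewrite eqn_leq size_nf /=.
  by rewrite sw -pw -prod_nf; apply: len_le; apply: letters_nf.
move=> gu gv; rewrite -(nfE u gu) -(nfE v gv).
by case: gu gv => [lu pu _] [lv pv _]; apply: teq_nf; rewrite // pu pv.
Qed.

Lemma odd_len u : letters u -> odd (len S (\prod_(a <- u) a)) = odd (size u).
Proof.
move=> lu; have [v [lv pv <-]] := geod_exists (\prod_(a <- u) a).
rewrite -odd_size_nf -[RHS]odd_size_nf.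
by rewrite (teq_size (teq_nf lv lu pv)).
Qed.

Lemma letters_cons a u : letter a -> letters u -> letters (a :: u).
Proof. by move=> la lu b; rewrite inE => /predU1P[->//|/lu]. Qed.

Lemma letters_cat u v : letters u -> letters v -> letters (u ++ v).
Proof. by move=> lu lv a; rewrite mem_cat => /orP[/lu|/lv]. Qed.

Lemma len1 : len S 1 = 0%N.
Proof.
have := @len_le [::]; rewrite big_nil leqn0 => h; apply/eqP/h => a.
by rewrite in_nil.
Qed.

Lemma len_eq0 x : len S x = 0%N -> x = 1.
Proof.
have [u [_ pu su]] := geod_exists x => e; rewrite e in su.
by rewrite -pu (size0nil su) big_nil.
Qed.

Lemma lenM x y : len S (x * y) <= len S x + len S y.
Proof.
have [[u [lu <- <-]] [v [lv <- <-]]] := (geod_exists x, geod_exists y).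
by rewrite -big_cat -size_cat; apply/len_le/letters_cat.
Qed.

Lemma lenV x : len S x^-1 = len S x.
Proof.
suff le y : len S y^-1 <= len S y by apply/eqP; rewrite eqn_leq -{3}(invgK x) !le.
have [u [lu <- <-]] := geod_exists y.
rewrite -{1}(revK u) -prodgV -(size_rev u) -(size_map (@inv G)).
rewrite -(big_map _ xpredT id).
apply: len_le => a /mapP[b]; rewrite mem_rev => /lu lb ->; exact: letterV.
Qed.

(** The lengths differ by at most one, and parity ([odd_len]) excludes equality. *)
Lemma len_letterM a x : letter a ->
  len S (a * x) = (len S x).+1 \/ len S x = (len S (a * x)).+1.
Proof.
move=> la; have [u [lu pu su]] := geod_exists x.
have lau := letters_cons la lu.
have := odd_len lau; have := len_le lau; rewrite big_cons pu /= su => h1.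
have [v [lv pv sv]] := geod_exists (a * x).
have := len_le (letters_cons (letterV la) lv); rewrite big_cons pv mulKg /= sv.
lia.
Qed.

Lemma len_letter a : letter a -> len S a = 1%N.
Proof.
by move=> la; have := len_letterM 1 la; rewrite mulg1 len1; case.
Qed.

(* The cube condition; it encapsulates the solution of the word problem. *)
Lemma cube s t x : letter s -> letter t -> s != t ->
  len S x = (len S (s^-1 * x)).+1 -> len S x = (len S (t^-1 * x)).+1 ->
  ind s t /\ len S (s^-1 * x) = (len S (t^-1 * (s^-1 * x))).+1.
Proof.
move=> ls lt st hs ht.
have [u [lu pu su]] := geod_exists (s^-1 * x).
have [v [lv pv sv]] := geod_exists (t^-1 * x).
have gs : geod x (s :: u).
  split; [exact: letters_cons|by rewrite big_cons pu mulVKg|by rewrite /= su].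
have gt : geod x (t :: v).
  split; [exact: letters_cons|by rewrite big_cons pv mulVKg|by rewrite /= sv].
have := front_teq (geod_teq gs gt) => /=; rewrite (negbTE st) /= => /andP[i f].
split; first by rewrite ind_sym.
have [|e|] := @len_letterM t^-1 (s^-1 * x); [exact: letterV| |by []].
have : len S (\prod_(a <- rem t u) a) <= size (rem t u).
  by apply: len_le => a /mem_rem/lu.
have -> : \prod_(a <- rem t u) a = t^-1 * (s^-1 * x).
  by rewrite -pu (prod_front f) mulKg.
by have /= := teq_size (frontE f); rewrite e su; lia.
Qed.

End Length.

(** * Halfspaces and medians *)

Section Halfspaces.
Variables (G : groupType) (S : set G).
Hypothesis hGS : raag S.
Implicit Types (a b c s t : G) (u v w p q r x y z : G) (h k : G -> bool).

Local Notation letter := (letter S).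
Local Notation len := (len S).

Definition first s x := len x == (len (s^-1 * x)).+1.

Lemma firstPn s x : letter s -> ~~ first s x -> len (s^-1 * x) = (len x).+1.
Proof.
move=> ls; have := len_letterM hGS x (letterV ls).
by rewrite /first => -[//|->]; rewrite eqxx.
Qed.

Lemma firstN s x : letter s -> first s^-1 (s^-1 * x) = ~~ first s x.
Proof.
move=> ls; rewrite /first invgK mulVKg.
case: (len_letterM hGS x (letterV ls)) => ->; rewrite eqxx; last exact/ltn_eqF.
by apply/esym/negP => /eqP; len_lia.
Qed.

Lemma first_exists x : x <> 1 -> exists2 t, letter t & first t x.
Proof.
have [[|a u] [lu pu su]] := geod_exists hGS x; first by rewrite -pu big_nil.
move=> _; have la : letter a by apply: lu; rewrite mem_head.
have lu' : letters S u by move=> b bu; apply: lu; rewrite inE bu orbT.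
exists a => //; apply: contraT => /(firstPn la).
by have := len_le hGS lu'; rewrite -su -pu big_cons mulKg /=; len_lia.
Qed.

Lemma first1 s : first s 1 = false.
Proof. by rewrite /first (len1 hGS). Qed.

Lemma first_letter s a : letter a -> first s a = (a == s).
Proof.
move=> la; rewrite /first (len_letter hGS la); apply/idP/eqP => [/eqP[/esym]|->].
  by move=> /(len_eq0 hGS)/(canRL (mulKg _)); rewrite mulg1 invgK.
by rewrite mulVg (len1 hGS).
Qed.

Lemma first_cube s t x : letter s -> letter t -> s != t ->
  first s x -> first t x -> ind s t /\ first t (s^-1 * x).
Proof.
move=> ls lt st /eqP hs /eqP ht; have [i e] := cube hGS ls lt st hs ht.
by split=> //; apply/eqP.
Qed.

Lemma first_cat s x y : letter s -> len (x * y) = (len x + len y)%N ->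
  first s x -> first s (x * y).
Proof.
move=> ls e /eqP f; apply: contraT => /(firstPn ls).
by have := lenM hGS (s^-1 * x) y; rewrite -!mulgA; len_lia.
Qed.

(** If [r] lengthens [y], then [s^-1] commutes past [r] and still shortens the product; if [r]
    cancels, [r^-1] and [s] are both initial in [y] and the cube condition applies. The converse
    uses [t^-1]. *)
Lemma first_ind s t x : letter s -> letter t -> ind s t ->
  first s (t * x) = first s x.
Proof.
move=> ls lt i; suff fw r y : letter r -> ind s r -> first s y -> first s (r * y).
  apply/idP/idP; last exact: fw.
  move/(fw t^-1); rewrite mulKg indVr; apply=> //; exact: letterV.
move=> lr {}i f; case: (len_letterM hGS y lr) => e.
  apply: contraT => /(firstPn ls).
  rewrite mulgA (@ind_comm _ s^-1 r) ?indVl // -mulgA e.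
  have := lenM hGS r (s^-1 * y); rewrite (len_letter hGS lr).
  by move/eqP: f; len_lia.
have fr : first r^-1 y by rewrite /first invgK; apply/eqP.
have rs : r^-1 != s by apply: contraTneq i => <-; rewrite -indVr indxx.
by have [_] := first_cube (letterV lr) ls rs fr f; rewrite invgK.
Qed.

(* Membership in the subgroup generated by the link of [s]. *)
Definition link s x := exists u : seq G,
  [/\ letters S u, all (ind s) u & \prod_(a <- u) a = x].

Lemma link1 s : link s 1.
Proof. by exists [::]; rewrite big_nil; split. Qed.

Lemma link_cons s t x : letter t -> ind s t -> link s x -> link s (t * x).
Proof.
move=> lt i [u [lu iu pu]]; exists (t :: u); rewrite big_cons pu /= i iu.
by split=> //; apply: letters_cons.
Qed.

Lemma link_ind (P : G -> Prop) s : P 1 ->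
  (forall t x, letter t -> ind s t -> link s x -> P x -> P (t * x)) ->
  forall x, link s x -> P x.
Proof.
move=> P1 PM x [u [lu iu <-]] {x}; elim: u lu iu => [|a u IH] lu.
  by rewrite big_nil.
move=> /andP[ia iu]; rewrite big_cons.
have la : letter a by apply: lu; rewrite mem_head.
have {}lu : letters S u by move=> b bu; apply: lu; rewrite inE bu orbT.
by apply: PM => //; [exists u|apply: IH].
Qed.

Lemma linkM s x y : link s x -> link s y -> link s (x * y).
Proof.
move=> + ky; elim/link_ind: x / => [|t x lt i _]; first by rewrite mul1g.
by rewrite -mulgA; apply: link_cons.
Qed.

Lemma linkV s x : link s x -> link s x^-1.
Proof.
elim/link_ind: x / => [|t x lt i _ IH]; first by rewrite invg1; apply: link1.
rewrite invgM; apply: linkM => //; rewrite -[t^-1]mulg1; apply: link_cons.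
- exact: letterV.
- by rewrite indVr.
exact: link1.
Qed.

Lemma link_comm s x : link s x -> x * s = s * x.
Proof.
elim/link_ind: x / => [|t x lt i _ IH]; first by rewrite mulg1 mul1g.
by rewrite -mulgA IH !mulgA (ind_comm i).
Qed.

Lemma first_link s x y : letter s -> link s x -> first s (x * y) = first s y.
Proof.
move=> ls; elim/link_ind: x / => [|t x lt i _ IH]; first by rewrite mul1g.
by rewrite -mulgA first_ind.
Qed.

Lemma first_link_self s x : letter s -> link s x -> first s x = false.
Proof. by move=> ls kx; rewrite -[x]mulg1 first_link ?first1. Qed.

(** Initial letters of [x] are stripped one by one: each is also initial in [x * y], hence
    independent of [s] by the cube condition. *)
Lemma first_catP s x y : letter s -> len (x * y) = (len x + len y)%N ->
  first s (x * y) -> ~~ first s x -> link s x /\ first s y.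
Proof.
move=> ls; have [n] := ubnP (len x); elim: n x => // n IH x ltn e fxy nfx.
case: (pselect (x = 1)) => [x1|/first_exists[t lt ft]].
  by rewrite x1 mul1g in fxy *; split=> //; apply: link1.
have st : t != s by apply: contraNneq nfx => <-.
have [i f] := first_cube lt ls st (first_cat lt e ft) fxy.
rewrite ind_sym in i; have ex := eqP ft.
have exy := eqP (first_cat lt e ft).
rewrite mulgA in f exy.
have [||//||kx fy] := IH (t^-1 * x); [len_lia|len_lia| |].
  by rewrite first_ind ?indVr //; apply: letterV.
by split=> //; rewrite -[x](mulVKg t); apply: link_cons.
Qed.

Lemma first_edge s x a : letter s -> letter a ->
  ~~ first s x -> first s (x * a) -> a = s /\ link s x.
Proof.
move=> ls la nf f.
have [|e] := len_letterM hGS x^-1 (letterV la).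
  rewrite -invgM !(lenV hGS) => e.
  have [||//|kx] := first_catP (x := x) (y := a) ls.
  - by rewrite (len_letter hGS la) addn1.
  - by [].
  by rewrite first_letter // => /eqP.
(* Here [a] shortens [x], so [s^-1 * x] and [s^-1 * x * a] would have lengths differing by 3 across
   one edge. *)
exfalso; move: e; rewrite -invgM !(lenV hGS) => e.
have := lenM hGS (s^-1 * (x * a)) a^-1.
rewrite -!mulgA mulgV mulg1 (firstPn ls nf) (lenV hGS) (len_letter hGS la).
by move/eqP: f; len_lia.
Qed.

(** * The word metric and its halfspaces *)

Definition dist x y := len (x^-1 * y).

Ltac dist_lia := unfold dist in *; len_lia.

Lemma distE x y : dist x y = len (x^-1 * y).
Proof. by []. Qed.

Lemma distC x y : dist x y = dist y x.
Proof. by rewrite /dist -(lenV hGS) invgM invgK. Qed.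

Lemma distM w x y : dist (w * x) (w * y) = dist x y.
Proof. by rewrite /dist invgM -mulgA mulKg. Qed.

Lemma dist_triangle x y z : dist x z <= dist x y + dist y z.
Proof.
by apply: leq_trans (lenM hGS _ _); rewrite -mulgA mulVKg.
Qed.

Lemma dist0 x y : dist x y = 0%N -> x = y.
Proof. by move/(len_eq0 hGS)/mulg1_eq; rewrite invgK. Qed.

Lemma distxx x : dist x x = 0%N.
Proof. by rewrite /dist mulVg (len1 hGS). Qed.

Lemma dist_edge x t : letter t -> dist x (x * t) = 1%N.
Proof. by move=> lt; rewrite /dist mulKg (len_letter hGS). Qed.

Lemma dist_first x y t : letter t -> first t (x^-1 * y) ->
  dist x y = (dist (x * t) y).+1.
Proof. by move=> lt /eqP; rewrite /dist invgM -mulgA. Qed.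

Lemma step_exists x y : x <> y -> exists2 t, letter t & first t (x^-1 * y).
Proof.
move=> xy; apply: first_exists => e; apply: xy; apply: dist0.
by rewrite /dist e (len1 hGS).
Qed.

(** The side of the edge from [g] to [g * s] that contains [g * s]. The label [s] records the
    orientation and is shared by all translates. *)
Definition halfspace s h := letter s /\ exists g, forall x, h x = first s (g^-1 * x).

Lemma half_first s x : letter s -> halfspace s (fun z => first s (x^-1 * z)).
Proof. by move=> ls; split=> //; exists x. Qed.

Lemma half_shift s h w : halfspace s h -> halfspace s (fun x => h (w * x)).
Proof.
case=> ls [g hg]; split=> //; exists (w^-1 * g) => x.
by rewrite hg invgM invgK mulgA.
Qed.

Lemma halfC s h : halfspace s h -> halfspace s^-1 (fun x => ~~ h x).
Proof.
case=> ls [g hg]; split; first exact: letterV.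
by exists (g * s) => x; rewrite hg -firstN // invgM mulgA.
Qed.

Lemma half_exists s h : halfspace s h -> exists x, h x.
Proof.
by case=> ls [g hg]; exists (g * s); rewrite hg mulKg first_letter ?eqxx.
Qed.

(** By [first_edge] the new base point differs from [g] by an element of the link of [s], which does
    not affect whether [s] is initial. *)
Lemma half_edge s h x t : halfspace s h -> letter t -> ~~ h x -> h (x * t) ->
  t = s /\ h =1 (fun z => first s (x^-1 * z)).
Proof.
case=> ls [g hg] lt; rewrite !hg mulgA => nf f.
have [-> k] := first_edge ls lt nf f; split=> // z.
by rewrite hg -[in LHS](mulVKg x z) mulgA first_link.
Qed.

(** Along a geodesic from [p] to [q], [x * t] is the first vertex in [h]; the two distance equations
    place this edge on the geodesic. *)
Lemma cross h p q : ~~ h p -> h q -> exists x t,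
  [/\ letter t, ~~ h x, h (x * t), dist p q = (dist p x + dist x q)%N &
      dist x q = (dist (x * t) q).+1].
Proof.
have [n] := ubnP (dist p q); elim: n p => // n IH p ltn np hq.
have [t lt ft] : exists2 t, letter t & first t (p^-1 * q).
  by apply: step_exists => e; rewrite e hq in np.
have e := dist_first lt ft.
have [hpt|npt] := boolP (h (p * t)).
  by exists p, t; rewrite distxx.
have [||//|x [t' [lt' nx hx e1 e2]]] := IH (p * t); first by lia.
  by [].
exists x, t'; split=> //.
have := dist_triangle p x q; have := dist_triangle p (p * t) x.
rewrite dist_edge //; dist_lia.
Qed.

(** If [r] were outside, the paths from [r] to [q] and to [p] would enter [h] by parallel edges at
    [x] and [y]. Passing through [y * s] and [x * s] would then shorten the path from [p] to [q] by
    two. *)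
Lemma half_convex s h p q r : halfspace s h -> h p -> h q ->
  (dist p r + dist r q)%N = dist p q -> h r.
Proof.
move=> hh hp hq e; apply: contraT => nr.
have [x [t [lt nx hx e1 e2]]] := cross nr hq.
have [y [t' [lt' ny hy e3 e4]]] := cross nr hp.
have [ts hE] := half_edge hh lt nx hx.
have [ts' _] := half_edge hh lt' ny hy; subst t t'.
have ls := lt.
have [_ k] : s = s /\ link s (x^-1 * y).
  by apply: first_edge => //; rewrite -?mulgA -hE.
have par : dist (y * s) (x * s) = dist y x.
  rewrite distC (distC y) /dist invgM -mulgA; congr Defs.len.
  by rewrite (mulgA x^-1) (link_comm k) mulgA mulVg mul1g.
have := dist_triangle p (y * s) q; have := dist_triangle (y * s) (x * s) q.
have := dist_triangle y r x; rewrite par (distC p (y * s)).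
move: e1 e2 e3 e4 e; rewrite (distC p r) (distC y r); dist_lia.
Qed.

Lemma half_sep p q : p <> q -> exists s h, [/\ halfspace s h, ~~ h p & h q].
Proof.
move/step_exists=> [t lt ft]; exists t, (fun z => first t (p^-1 * z)).
by split; [apply: half_first|rewrite mulVg first1|].
Qed.

(** Converse of convexity, by walking from [p] towards [z]. The first edge enters a halfspace that
    contains [q] too, for its complement cannot contain both [p] and [q] while missing [z]; so the
    step also approaches [q]. *)
Lemma dist_between p q z :
  (forall s h, halfspace s h -> h p -> h q -> h z) ->
  (dist p z + dist z q)%N = dist p q.
Proof.
have [n] := ubnP (dist p z); elim: n p => // n IH p ltn bt.
case: (pselect (p = z)) => [->|/step_exists[t lt ft]]; first by rewrite distxx.
have e := dist_first lt ft.
have fq : first t (p^-1 * q).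
  apply: contraT => nf; have hC := halfC (half_first p lt).
  have np : ~~ first t (p^-1 * p) by rewrite mulVg first1.
  by have /negP := bt _ _ hC np nf.
rewrite e (dist_first lt fq) addSn IH //; first by rewrite -ltnS -e.
move=> s h hh hpt hq; have [hp|np] := boolP (h p); first exact: (bt s h).
by have [ts ->] := half_edge hh lt np hpt; rewrite -ts.
Qed.

Lemma len_disjoint x y :
  (forall a, letter a -> first a x -> first a y -> False) ->
  dist x y = (len x + len y)%N.
Proof.
(* Replacing [x] by its inverse lets the induction strip letters at the end away from [y]. *)
rewrite /dist -(lenV hGS x) -{1}(invgK x); move: x^-1 => {}x.
have [n] := ubnP (len x); elim: n x => // n IH x ltn dj.
case: (pselect (x = 1)) => [->|/first_exists[a la fa]].
  by rewrite mul1g (len1 hGS).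
have ea := eqP fa.
have dj' b : letter b -> first b (a^-1 * x)^-1 -> first b y -> False.
  move=> lb fb; apply: dj => //.
  rewrite -[x](mulVKg a) invgM; apply: first_cat => //.
  by rewrite -invgM !(lenV hGS) mulVKg (len_letter hGS la) ea addn1.
have {}IH := IH _ _ dj'; rewrite ea in ltn; have {}IH := IH ltn.
have : letter a^-1 by apply: letterV.
move=> laV; case: (boolP (first a^-1 (a^-1 * x * y))) => [f|/(firstPn laV)].
  exfalso; have nf : ~~ first a^-1 (a^-1 * x) by rewrite firstN // negbK.
  have [k fy] := first_catP laV IH f nf.
  apply: (dj a^-1) => //; rewrite -[x](mulVKg a) invgM.
  by rewrite first_link ?first_letter //; apply: linkV.
rewrite invgK -!mulgA mulVKg => ->; move: IH; rewrite -mulgA. len_lia.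
Qed.

(** * Meets and medians *)

Lemma gleE x y z : gle S (x^-1 * z) (x^-1 * y) <-> (dist x z + dist z y)%N = dist x y.
Proof. by rewrite /gle -/(dist (x^-1 * z) (x^-1 * y)) distM. Qed.

(** Stripping common initial letters until none remains gives [m] as their product; [len_disjoint]
    then applies to the remainders. *)
Lemma center_exists x y : exists m,
  [/\ gle S m x, gle S m y & dist x y = (dist x m + dist m y)%N].
Proof.
have [n] := ubnP (len x); elim: n x y => // n IH x y ltn.
case: (pselect (exists a, [/\ letter a, first a x & first a y])); last first.
  move=> none; exists 1; rewrite /gle invg1 !mul1g (len1 hGS).
  split=> //; rewrite (distC x 1) /dist invg1 !mul1g; apply: len_disjoint.
  by move=> a la fx fy; apply: none; exists a.
move=> [a [la fx fy]]; have ex := eqP fx; have ey := eqP fy.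
have [|m [mx my e]] := IH (a^-1 * x) (a^-1 * y); first by rewrite -ltnS -ex.
have gle_a z : len z = (len (a^-1 * z)).+1 -> gle S m (a^-1 * z) -> gle S (a * m) z.
  rewrite /gle => ez; rewrite invgM -mulgA => e1.
  have := lenM hGS a m; have := lenM hGS (a * m) (m^-1 * (a^-1 * z)).
  by rewrite -mulgA !mulVKg (len_letter hGS la); len_lia.
exists (a * m); split; [exact: gle_a|exact: gle_a|].
by rewrite -!(distM a^-1 x) -(distM a^-1 (a * m)) mulKg.
Qed.

Definition maj (a b c : bool) := a && b || b && c || c && a.

Lemma half_maj s h x y z m : halfspace s h ->
  (dist x m + dist m y)%N = dist x y -> (dist y m + dist m z)%N = dist y z ->
  (dist x m + dist m z)%N = dist x z -> h m = maj (h x) (h y) (h z).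
Proof.
move=> hh xy yz xz; have hC := halfC hh.
have C p q : h p -> h q -> (dist p m + dist m q)%N = dist p q -> h m.
  by move=> hp hq; apply: half_convex hh hp hq.
have N p q : ~~ h p -> ~~ h q -> (dist p m + dist m q)%N = dist p q -> ~~ h m.
  by move=> hp hq; apply: (half_convex hC hp hq).
rewrite /maj; have [hx|hx] := boolP (h x); have [hy|hy] := boolP (h y);
  have [hz|hz] := boolP (h z); rewrite /= ?orbT; 
  solve [exact: C xy | exact: C yz | exact: C xz
  | exact/negbTE/(N _ _ _ _ xy) | exact/negbTE/(N _ _ _ _ yz)
  | exact/negbTE/(N _ _ _ _ xz)].
Qed.

Lemma gle_half x y : (forall s h, halfspace s h -> h 1 -> h y -> h x) -> gle S x y.
Proof.
by move=> /dist_between; rewrite -gleE invg1 !mul1g.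
Qed.

Lemma gleP x y : gle S x y <-> (dist 1 x + dist x y)%N = dist 1 y.
Proof. by rewrite -gleE invg1 !mul1g. Qed.

Lemma gmeetP x y : gle S (gmeet S x y) x /\ gle S (gmeet S x y) y /\
  (dist x (gmeet S x y) + dist (gmeet S x y) y)%N = dist x y.
Proof.
have [m [mx my e]] := center_exists x y.
have glb : is_glb S x y m.
  split=> // u /gleP ux /gleP uy; apply: gle_half => s h hh h1 hm.
  (* A halfspace containing 1 but not [u] contains neither [x] nor [y], hence not [m], which lies
     between them. *)
  have hC := halfC hh; apply: contraT => nu.
  have nx : ~~ h x by apply: contra nu => hx; apply: half_convex hh h1 hx ux.
  have ny : ~~ h y by apply: contra nu => hy; apply: half_convex hh h1 hy uy.
  by have := half_convex hC nx ny (esym e); rewrite hm.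
suff -> : gmeet S x y = m by [].
rewrite /gmeet; case: xgetP => [m' _ [m'x m'y gm']|/(_ m)//].
have [_ _ gm] := glb; have mm' := gm' _ mx my; have m'm := gm _ m'x m'y.
apply: dist0; move: mm' m'm; rewrite /gle -/(dist m m') -/(dist m' m) (distC m m').
by dist_lia.
Qed.

Lemma half_median s h x y z : halfspace s h ->
  h (median S x y z) = maj (h x) (h y) (h z).
Proof.
move=> hh; rewrite /median; set m := gmeet _ _ _.
have [mx [my e]] := gmeetP (x^-1 * y) (x^-1 * z); rewrite -/m in mx my e.
have xm : x^-1 * (x * m) = m by rewrite mulKg.
apply: half_maj hh _ _ _; try by apply/gleE; rewrite xm.
by rewrite -!(distM x^-1 y) -(distM x^-1 (x * m)) mulKg.
Qed.

Lemma half_eq x y : (forall s h, halfspace s h -> h x = h y) -> x = y.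
Proof.
move=> e; apply: contrapT => /half_sep[s [h [hh nx hy]]].
by rewrite (e s h hh) hy in nx.
Qed.

Lemma intervalP x y z : interval S x y z <->
  forall s h, halfspace s h -> h x -> h y -> h z.
Proof.
rewrite /interval /= gleE; split; last exact: dist_between.
by move=> e s h hh hx hy; apply: half_convex hh hx hy e.
Qed.
End Halfspaces.

(** * Translates of a halfspace *)

Section Translates.
Variables (G : groupType) (S : set G).
Hypothesis hGS : raag S.
Implicit Types (a b c s t : G) (u v w p q r x y z : G) (h k : G -> bool).

Local Notation letter := (letter S).
Local Notation len := (len S).
Local Notation halfspace := (halfspace S).
Local Notation link := (link S).
Local Notation first := (first S).
Local Notation dist := (dist S).


(** A path labelled by letters independent of [s] could cross the boundary of [k] only along an edge
    labelled [t] or [t^-1]. *)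
Lemma half_link s t k x u : link s u -> halfspace t k -> ~~ ind s t ->
  k (x * u) = k x.
Proof.
move=> + hk /negP st; move=> lu; elim/link_ind: u / lu x => [|a u la i _ IH] x.
  by rewrite mulg1.
rewrite mulgA IH; have [kx|nkx] := boolP (k x).
  apply: contraT => nk; case: st.
  have kx' : k (x * a * a^-1) by rewrite mulgK.
  by have [<- _] := half_edge hGS hk (letterV la) nk kx'; rewrite indVr.
apply/negbTE/negP => kxa; case: st.
by have [<- _] := half_edge hGS hk la nkx kxa.
Qed.

Lemma half_boundary s t h k p q : halfspace s h -> halfspace t k -> k p -> k q ->
  ~~ h p -> h q -> exists x, [/\ k x, ~~ h x & h (x * s)].
Proof.
move=> hh hk kp kq np hq.
have [x [a [la nx hx e _]]] := cross hGS np hq; exists x.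
have [<- _] := half_edge hGS hh la nx hx.
by split=> //; apply: (half_convex hGS hk kp kq (esym e)).
Qed.

(* Hyperplanes that cross bound a square, whose sides carry different labels. *)
Lemma half_nested s h k : halfspace s h -> halfspace s k ->
  [\/ forall x, ~~ (h x && k x), forall x, h x -> k x,
      forall x, k x -> h x | forall x, h x || k x].
Proof.
move=> hh hk.
have [p1|/forallNP n1] := pselect (exists x, h x && k x); last first.
  by constructor 1 => x; apply/negP.
have [p2|/forallNP n2] := pselect (exists x, h x && ~~ k x); last first.
  by constructor 2 => x hx; apply: contraT => nk; case: (n2 x); rewrite hx.
have [p3|/forallNP n3] := pselect (exists x, ~~ h x && k x); last first.
  by constructor 3 => x hx; apply: contraT => nk; case: (n3 x); rewrite nk.
have [p4|/forallNP n4] := pselect (exists x, ~~ h x && ~~ k x); last first.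
  by constructor 4 => x; apply/norP => /andP/n4.
exfalso; case: p1 p2 p3 p4 => [p1 /andP[h1 k1]] [p2 /andP[h2 k2]].
move=> [p3 /andP[h3 k3]] [p4 /andP[h4 k4]].
have ls := hh.1.
have [x [kx nx hx]] := half_boundary hh hk k3 k1 h3 h1.
have [y [ky ny hy]] := half_boundary hh (halfC hGS hk) k4 k2 h4 h2.
have [_ hE] := half_edge hGS hh ls nx hx.
have [_ l] : s = s /\ link s (x^-1 * y).
  by apply: (first_edge hGS) => //; rewrite -?mulgA -hE.
have := half_link x l hk; rewrite indxx mulVKg kx => /(_ isT) e.
by rewrite e in ky.
Qed.

Lemma link_first s t z : link s z -> letter t -> first t z -> ind s t.
Proof.
move=> l lt f; apply: contraT => i.
have := half_link 1 l (half_first 1 lt) i.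
by rewrite invg1 !mul1g f first1.
Qed.

(** Every initial letter of a link element is independent of [s] by [link_first], so [x] can be
    peeled letter by letter. *)
Lemma link_prefix s x y : len (x * y) = (len x + len y)%N -> link s (x * y) ->
  link s x.
Proof.
have [n] := ubnP (len x); elim: n x => // n IH x ltn e l.
case: (pselect (x = 1)) => [->|/(first_exists hGS)[t lt ft]]; first exact: link1.
have ex := eqP ft; have fxy := first_cat hGS lt e ft; have exy := eqP fxy.
have i := link_first l lt fxy.
rewrite -[x](mulVKg t); apply: link_cons => //; apply: IH.
- by len_lia.
- by rewrite -mulgA; len_lia.
rewrite -mulgA; apply: linkM => //; rewrite -[t^-1]mulg1.
by apply: link_cons; [apply: letterV|rewrite indVr|apply: link1].
Qed.

(** * Cyclic reduction and roots *)

Lemma len_first_mulr a x : letter a -> first a x^-1 -> len x = (len (x * a)).+1.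
Proof.
by move=> la /eqP; rewrite -invgM !(lenV hGS).
Qed.

Lemma cyclic_reduction w : exists g u,
  [/\ w = g * u * g^-1, len w = (len g + len u + len g)%N &
      forall a, letter a -> first a u -> first a u^-1 -> False].
Proof.
suff red n g u : len u < n -> w = g * u * g^-1 ->
    len w = (len g + len u + len g)%N -> exists g u,
    [/\ w = g * u * g^-1, len w = (len g + len u + len g)%N &
      forall a, letter a -> first a u -> first a u^-1 -> False].
  by apply: (red (len w).+1 1 w); rewrite // ?invg1 ?mul1g ?mulg1 ?(len1 hGS) ?addn0.
elim: n g u => // n IH g u ltn e el.
case: (pselect (exists a, [/\ letter a, first a u & first a u^-1])); last first.
  by move=> no; exists g, u; split=> // a la f f'; apply: no; exists a.
move=> [a [la f f']].
have eu := eqP f; have eua := len_first_mulr la f'.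
have ew : w = (g * a) * (a^-1 * u * a) * (g * a)^-1.
  by rewrite e invgM !mulgA !mulgK.
have eau : len u = (len (a^-1 * u * a)).+2.
  have E : a * (a^-1 * u * a)^-1 = (a^-1 * u)^-1 by rewrite invgM mulVKg.
  have := len_letterM hGS (a^-1 * u * a)^-1 la; rewrite E !(lenV hGS).
  case=> e1; first by len_lia.
  (* If conjugation did not gain two letters, the edge from [u * a] to [u], labelled [a^-1], would
     enter a halfspace labelled [a]. *)
  exfalso; have nf : ~~ first a (u * a).
    by rewrite -firstN // /first invgK mulVKg mulgA; apply/eqP; len_lia.
  have [|aV _] := first_edge hGS la (letterV la) nf; first by rewrite mulgK.
  by have := letter_neqV hGS la; rewrite aV eqxx.
have ega : len w <= len (g * a) + len (a^-1 * u * a) + len (g * a).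
  rewrite {1}ew; apply: leq_trans (lenM hGS _ _) _; rewrite (lenV hGS) leq_add2r.
  exact: lenM.
have := lenM hGS g a; rewrite (len_letter hGS la) => ga.
by apply: (IH _ _ _ ew); len_lia.
Qed.

(* If w = g u g^-1 is a cyclic reduction, then w^n.+1 = g (u (u^n g^-1)) without
   cancellation, so that [g] and [u] only involve letters of [w ^+ n.+1]. *)
Lemma link_root s w n : link s (w ^+ n.+1) -> link s w.
Proof.
have [g [u [ew el red]]] := cyclic_reduction w.
have disj x y : (forall a, letter a -> first a x^-1 -> first a y -> False) ->
    len (x * y) = (len x + len y)%N.
  by move/(len_disjoint hGS); rewrite distE invgK (lenV hGS).
have eug : len (u * g^-1) = (len u + len g)%N.
  have := lenM hGS g (u * g^-1); have := lenM hGS u g^-1.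
  by rewrite mulgA -ew (lenV hGS); len_lia.
have egu : len (g * u) = (len g + len u)%N.
  have := lenM hGS (g * u) g^-1; have := lenM hGS g u.
  by rewrite -ew (lenV hGS); len_lia.
(* A letter cancelling here is initial in [u^-1]; it is either initial in [u], against cyclic
   reduction, or has [u] in its link, which keeps it from being initial in [u^-1]. *)
have uu m : len (u * (u ^+ m * g^-1)) = (len u + len (u ^+ m * g^-1))%N.
  elim: m => [|m IH]; first by rewrite expg0 mul1g eug (lenV hGS).
  apply: disj => a la fV; rewrite expgS -mulgA => f.
  have [fu|nfu] := boolP (first a u); first exact: red fu fV.
  have [l _] := first_catP hGS la IH f nfu.
  by rewrite (first_link_self hGS la (linkV l)) in fV.
(* A letter [a] cancelling here is either initial in [u], against [egu], or commutes with [u]; then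
   [g * a] conjugates [u] to [w] and is shorter than [g], against the length of [w]. *)
have guu : len (g * (u * (u ^+ n * g^-1))) =
    (len g + len (u * (u ^+ n * g^-1)))%N.
  apply: disj => a la fV f; have ega := len_first_mulr la fV.
  have [fu|nfu] := boolP (first a u).
    have := lenM hGS (g * a) (a^-1 * u); move/eqP: fu.
    by rewrite mulgA mulgK; len_lia.
  have [l _] := first_catP hGS la (uu n) f nfu.
  have ew' : w = (g * a) * u * (g * a)^-1.
    by rewrite -[g * a * u]mulgA -(link_comm l) invgM !mulgA mulgK.
  have := lenM hGS (g * a * u) (g * a)^-1; have := lenM hGS (g * a) u.
  by rewrite -ew' (lenV hGS); len_lia.
have wn : w ^+ n.+1 = g * (u * (u ^+ n * g^-1)).
  have := conjXg u g^-1 n.+1; rewrite !conjgE invgK !mulgA -ew => <-.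
  by rewrite expgS !mulgA.
rewrite wn => l; have lg := link_prefix guu l.
rewrite mulgA in l; have lgu : link s (g * u).
  by apply: link_prefix l; rewrite -mulgA guu uu egu addnA.
by rewrite ew; apply: linkM => //; apply: linkV.
Qed.

(** The stabilizer of [h] is the conjugate by its base point of the link subgroup of [s], which is
    closed under roots by [link_root]. *)
Lemma half_stab_root s h w n : halfspace s h ->
  (forall x, h (w ^+ n.+1 * x) = h x) -> forall x, h (w * x) = h x.
Proof.
case=> ls [g hg] st x.
have E y z : h (y * z) = first s (y ^ g * (g^-1 * z)).
  by rewrite hg conjgE -!mulgA mulVKg.
have l : link s (w ^ g).
  apply: (@link_root s _ n); rewrite -conjXg.
  have [||//] := first_edge hGS (x := (w ^+ n.+1) ^ g) (a := s) ls ls.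
  - by rewrite -[_ ^ g]mulg1 -(mulVg g) -E st hg mulVg first1.
  by rewrite -{2}(mulKg g s) -E st hg mulKg first_letter ?eqxx.
by rewrite E first_link // hg.
Qed.

Lemma expgSM w n x : w ^+ n.+1 * x = w * (w ^+ n * x).
Proof. by rewrite expgS mulgA. Qed.

Lemma expgSrM w n x : w ^+ n.+1 * x = w ^+ n * (w * x).
Proof. by rewrite expgSr mulgA. Qed.

(** * Halfspaces under iteration of [w] *)

Definition absorbing w h (e : bool) :=
  forall a, exists N, forall n, N <= n -> h (w ^+ n * a) = e.

Lemma absorbing_ext w h k e : h =1 k -> absorbing w h e -> absorbing w k e.
Proof. by move=> hk ab a; have [N hN] := ab a; exists N => n /hN; rewrite hk. Qed.

Lemma absorbingC w h e : absorbing w (fun x => ~~ h x) e <-> absorbing w h (~~ e).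
Proof.
split=> ab a; have [N hN] := ab a; exists N => n /hN; last by move=> ->; rewrite negbK.
by move=> <-; rewrite negbK.
Qed.

(* The translates of [h] form a strictly increasing chain, of which at most
   [dist a b] members separate [b] from [a]. *)
Lemma absorbing_increasing s h w x0 : halfspace s h ->
  (forall x, h x -> h (w * x)) -> ~~ h x0 -> h (w * x0) -> absorbing w h true.
Proof.
move=> hh mono n0 h0 a.
suff [N hN] : exists N, h (w ^+ N * a).
  exists N => n /subnK <-; elim: (n - N)%N => // m IH.
  by rewrite addSn expgSM mono.
apply: contrapT => /forallNP na.
have hs n : halfspace s (fun x => h (w ^+ n * x)) by exact: half_shift (w ^+ n) hh.
have far m p n : h (w ^+ n * p) -> m <= dist a p.
  elim: m p n => // m IH p n hp.
  have [|x [t [lt nx hx e1 e2]]] := @cross _ _ hGS (fun x => h (w ^+ n * x)) a p _ hp.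
    exact/negP/na.
  suff : h (w ^+ n.+1 * x) by move/IH; rewrite e1 e2; lia.
  (* Otherwise one edge would enter two successive members of the chain and make them equal, but
     [w ^- n * x0] tells them apart. *)
  apply: contraT => nx'.
  have hx' : h (w ^+ n.+1 * (x * t)) by rewrite expgSM mono.
  have [_ E] := half_edge hGS (hs n) lt nx hx.
  have [_ E'] := half_edge hGS (hs n.+1) lt nx' hx'.
  have := E (w ^- n * x0); rewrite -E' mulVKg expgSM mulVKg h0.
  by rewrite (negbTE n0).
have [b hb] := half_exists hGS (hs 0%N).
by have := far (dist a b).+1 b 0%N hb; rewrite ltnn.
Qed.

(** The point is that [h] is disjoint from all its translates by positive powers ([djn]), so that an
    orbit visits [h] at most once. *)
Lemma absorbing_disjoint s h w : halfspace s h ->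
  (forall x, ~~ (h x && h (w * x))) -> absorbing w h false.
Proof.
move=> hh dj.
have [b0 hb0] := half_exists hGS hh.
(* Large powers of [z] would bring [b0] and [w * b0] into [h] at once, against disjointness. *)
have no_abs z : w * z = z * w -> ~ absorbing z h true.
  move=> wz ab; have [N1 h1] := ab b0; have [N2 h2] := ab (w * b0).
  have := dj (z ^+ maxn N1 N2 * b0); rewrite h1 ?leq_maxl //=.
  have -> : w * (z ^+ maxn N1 N2 * b0) = z ^+ maxn N1 N2 * (w * b0).
    by rewrite !mulgA (commuteX _ wz).
  by rewrite h2 ?leq_maxr.
have cw n : w * w ^+ n = w ^+ n * w by rewrite -expgS expgSr.
(* A strict inclusion makes [w ^+ n.+1] absorb into [h]; an equality makes [w] itself stabilize [h].
   Both are impossible. *)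
have no_sub n : ~ (forall x, h x -> h (w ^+ n.+1 * x)).
  move=> sub; have [[x0 /andP[nx hx]]|/forallNP no] :=
    pselect (exists x, ~~ h x && h (w ^+ n.+1 * x)).
    exact: no_abs (cw n.+1) (absorbing_increasing hh sub nx hx).
  have st x : h (w ^+ n.+1 * x) = h x.
    apply/idP/idP => [hx|]; last exact: sub.
    by apply: contraT => nx; case: (no x); rewrite nx.
  by have := dj b0; rewrite (half_stab_root hh st) hb0.
have no_sup n : ~ (forall x, h (w ^+ n.+1 * x) -> h x).
  move=> sup; have /existsNP[x0 /not_implyP[hx /negP nx]] := @no_sub n.
  apply: (no_abs (w ^- n.+1)).
    by rewrite (commuteV (cw n.+1 : commute _ _)).
  apply: (@absorbing_increasing s h (w ^- n.+1) (w ^+ n.+1 * x0)) => //.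
    by move=> x hx'; apply: sup; rewrite mulVKg.
  by rewrite mulKg.
have djn n x : h x -> ~~ h (w ^+ n.+1 * x).
  have hw := half_shift (w ^+ n.+1) hh.
  move=> hx; have [d|/no_sub//|/no_sup//|cov] := half_nested hh hw.
    by have := d x; rewrite hx.
  (* If [h] and its translate cover [G], a point [y] of [h] has [w * y] outside [h], hence
     [w ^+ n.+2 * y] inside, which [no_sub] forbids. *)
  case: (@no_sub n.+1) => y hy; have := dj y; rewrite hy /= => nwy.
  by have := cov (w * y); rewrite (negbTE nwy) -expgSrM.
move=> a; have [[N hN]|/forallNP no] := pselect (exists N, h (w ^+ N * a)).
  exists N.+1 => n /subnK <-; rewrite addnS -addSn expgnDr -mulgA.
  exact/negbTE/djn.
by exists 0%N => n _; apply/negbTE/negP.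
Qed.

(** The second clause retains the relative position of [h] and its translate, which the comparison
    with [preceq] requires. *)
Definition absorbed w h e := absorbing w h e /\
  ((forall x, h x = e -> h (w * x) = e) \/
   (forall x, h x = e \/ h (w * x) = e)).

Lemma halfspace_trichotomy s h w : halfspace s h ->
  (forall x, h (w * x) = h x) \/ exists e, absorbed w h e.
Proof.
move=> hh; have hw := half_shift w hh.
have hC := halfC hGS hh.
have [[x0 /andP[nx0 hx0]]|/forallNP n1] := pselect (exists x, ~~ h x && h (w * x));
have [[x1 /andP[hx1 nx1]]|/forallNP n2] := pselect (exists x, h x && ~~ h (w * x)).
- have [d|sub|sup|cov] := half_nested hh hw.
  + right; exists false; split; first exact: absorbing_disjoint hh d.
    by right=> x; have := d x; case: (h x) => /= [/negbTE|_]; [right|left].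
  + by rewrite sub in nx1.
  + by rewrite sup in nx0.
  right; exists true; split; last by right=> x; apply/orP/cov.
  apply/(absorbingC w h false)/(absorbing_disjoint hC) => x /=.
  by rewrite -negb_or negbK.
- have sub x : h x -> h (w * x).
    by move=> hx; apply: contraT => nx; case: (n2 x); rewrite hx.
  right; exists true; split; last by left.
  exact: absorbing_increasing hh sub nx0 hx0.
- have sup x : h x = false -> h (w * x) = false.
    by move=> hx; apply/negP => hwx; case: (n1 x); rewrite hx.
  right; exists false; split; last by left.
  apply/(absorbingC w h true); apply: (absorbing_increasing hC) nx1.
    by move=> x /negbTE/sup ->.
  by rewrite negbK.
left=> x; case e1: (h x); case e2: (h (w * x)) => //.
  by case: (n2 x); rewrite e1 e2.
by case: (n1 x); rewrite e1 e2.
Qed.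

(** Only the finitely many halfspaces bounded by edges of a geodesic from [b] to [a], and their
    complements, matter, so one bound serves them all. *)
Lemma absorbing_uniform w a b : exists N, forall n, N <= n ->
  forall s h e, halfspace s h -> h a != h b -> absorbing w h e ->
  h (w ^+ n * a) = e.
Proof.
have [m] := ubnP (dist b a); elim: m b => // m IH b ltm.
case: (pselect (b = a)) => [->|/(step_exists hGS)[t lt ft]].
  by exists 0%N => n _ s h e _; rewrite eqxx.
have [|N1 hN1] := IH (b * t).
  by rewrite -ltnS -(dist_first lt ft).
pose k := fun z => first t (b^-1 * z).
have [N2 hN2] : exists N, forall n, N <= n -> forall e, absorbing w k e ->
    k (w ^+ n * a) = e.
  have ev e : exists N, forall n, N <= n -> absorbing w k e -> k (w ^+ n * a) = e.
    have [/(_ a)[N hN]|nab] := pselect (absorbing w k e); last by exists 0%N.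
    by exists N => n /hN.
  have [[N hN] [N' hN']] := (ev true, ev false).
  exists (maxn N N') => n; rewrite geq_max => /andP[le le'] [] ab; first exact: hN.
  exact: hN'.
exists (maxn N1 N2) => n; rewrite geq_max => /andP[le1 le2] s h e hh nab ab.
have [eqt|neqt] := eqVneq (h (b * t)) (h b).
  by apply: hN1 hh _ ab => //; rewrite eqt.
case hb: (h b) in neqt *.
  have nt : ~~ h (b * t) by move: neqt; case: (h _).
  have nb : ~~ ~~ h b by rewrite hb.
  have [ts E] := half_edge hGS (halfC hGS hh) lt nb nt; rewrite -ts in E.
  apply: negb_inj; rewrite E; apply: (hN2 n le2).
  apply: absorbing_ext E _; apply/absorbingC; by rewrite negbK.
have hbt : h (b * t) by move: neqt; case: (h _).
have [ts E] := half_edge hGS hh lt (negbT hb) hbt; rewrite -ts in E.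
by rewrite E; apply: (hN2 n le2); apply: absorbing_ext E _.
Qed.

(** The third vote [h (w ^+ N * a)] matters only when [h] separates [a] from [b], where the uniform
    bound fixes its value. *)
Lemma absorbing_median w a b : exists c, forall s h, halfspace s h ->
  [/\ (forall x, h (w * x) = h x) -> h c = h a,
      absorbing w h true -> h c = h a || h b &
      absorbing w h false -> h c = h a && h b].
Proof.
have [N hN] := absorbing_uniform w a b.
exists (median S a b (w ^+ N * a)) => s h hh; rewrite (half_median hGS _ _ _ hh).
split=> [nt|ab|ab].
- have -> : h (w ^+ N * a) = h a by elim: (N) => [|n IH]; rewrite ?mul1g // expgSM nt.
  by rewrite /maj; case: (h a); case: (h b).
- have := hN N (leqnn N) s h true hh.
  by rewrite /maj; case: (h a); case: (h b) => /= X; rewrite ?(X isT ab) //; case: (h _).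
have := hN N (leqnn N) s h false hh.
by rewrite /maj; case: (h a); case: (h b) => /= X; rewrite ?(X isT ab) //; case: (h _).
Qed.

End Translates.

(** * The quasidirection of an element *)

Section Direction.
Variables (G : groupType) (S : set G).
Hypothesis hGS : raag S.
Implicit Types (a b c s t w x y z : G) (h : G -> bool) (op : G -> G -> G).

Local Notation halfspace := (halfspace S).

Lemma absorbing_shift w h e : absorbing w h e -> absorbing w (fun x => h (w * x)) e.
Proof.
move=> ab a; have [N hN] := ab a; exists N => n le.
by rewrite -expgSM hN // ltnW.
Qed.

Lemma absorbedC w h : absorbed w h false -> absorbed w (fun x => ~~ h x) true.
Proof.
case=> ab d; split; first exact/absorbingC.
by case: d => d; [left=> x /negbTE/d ->|right=> x; case: (d x) => ->; [left|right]].
Qed.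

(** In the monotone case, take the least [n] with [w ^+ n * y] in [h]. The pullback of [h] by the
    previous power of [w] contains [x] and [w * y], hence [y], against minimality. *)
Lemma preceq_absorbed s h w x y : halfspace s h -> absorbed w h true ->
  preceq S w x y -> h x -> h y.
Proof.
move=> hh [ab d] /(intervalP hGS) pre hx; apply: contraT => ny.
have nwy : ~~ h (w * y) by apply: contra ny; apply: pre hh hx.
case: d => [mono|cov]; last first.
  by case: (cov y) => hy; [rewrite hy in ny|rewrite hy in nwy].
have ex : exists n, h (w ^+ n * y).
  by have [N hN] := ab y; exists N; apply: hN.
case: (ex_minnP ex) => -[|n] hn min; first by rewrite expg0 mul1g (negbTE ny) in hn.
suff /min : h (w ^+ n * y) by rewrite ltnn.
apply: (pre s (fun z => h (w ^+ n * z)) (half_shift _ hh)); last by rewrite -expgSrM.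
by elim: (n) => [|m IH]; rewrite ?mul1g // expgSM mono.
Qed.

Lemma quasidirection_exists w : exists op, quasidirection (median S) op /\
  forall x y, preceq S w x y <-> op y x = y.
Proof.
have /choice[f hf] : forall p : G * G, exists c, forall s h, halfspace s h ->
  [/\ (forall x, h (w * x) = h x) -> h c = h p.1,
      absorbing w h true -> h c = h p.1 || h p.2 &
      absorbing w h false -> h c = h p.1 && h p.2].
  by move=> [a b]; apply: absorbing_median.
pose op a b := f (a, b).
have opN s h a b : halfspace s h -> (forall x, h (w * x) = h x) -> h (op a b) = h a.
  by move=> hh; case: (hf (a, b) s h hh).
have opT s h a b : halfspace s h -> absorbing w h true -> h (op a b) = h a || h b.
  by move=> hh; case: (hf (a, b) s h hh).
have opF s h a b : halfspace s h -> absorbing w h false -> h (op a b) = h a && h b.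
  by move=> hh; case: (hf (a, b) s h hh).
have opP s h : halfspace s h -> [\/ forall a b, h (op a b) = h a,
    forall a b, h (op a b) = h a || h b | forall a b, h (op a b) = h a && h b].
  move=> hh; case: (halfspace_trichotomy hGS w hh) => [nt|[[] [ab _]]].
  - by constructor 1 => a b; apply: opN hh nt.
  - by constructor 2 => a b; apply: opT hh ab.
  by constructor 3 => a b; apply: opF hh ab.
exists op; split; first split; first split.
- move=> x y z; apply: (half_eq hGS) => s h hh.
  by case: (opP s h hh) => e; rewrite !e ?orbA ?andbA.
- move=> x; apply: (half_eq hGS) => s h hh.
  by case: (opP s h hh) => e; rewrite !e ?orbb ?andbb.
- move=> x y z; apply: (half_eq hGS) => s h hh.
  by case: (opP s h hh) => e; rewrite !e // (orbAC, andbAC).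
- move=> a x y z; apply: (half_eq hGS) => s h hh.
  have M := half_median hGS _ _ _ hh.
  case: (opP s h hh) => e; rewrite !(M, e) /maj;
  by case: (h a); case: (h x); case: (h y); case: (h z).
- move=> x y z; apply: (half_eq hGS) => s h hh.
  have M := half_median hGS _ _ _ hh.
  case: (opP s h hh) => e; rewrite !(M, e) /maj;
  by case: (h x); case: (h y); case: (h z).
move=> x y; split=> [pre|e].
  apply: (half_eq hGS) => s h hh.
  case: (halfspace_trichotomy hGS w hh) => [nt|[[] ab]].
  - exact: opN hh nt.
  - rewrite (opT _ _ _ _ hh ab.1); have := preceq_absorbed hh ab pre.
    by case: (h x) => [->//|_]; rewrite orbF.
  rewrite (opF _ _ _ _ hh ab.1).
  have := preceq_absorbed (halfC hGS hh) (absorbedC ab) pre.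
  by case: (h x) => [_|/(_ isT)/negbTE->]; rewrite ?andbT.
apply/(intervalP hGS) => s h hh hx hwy.
case: (halfspace_trichotomy hGS w hh) => [nt|[[] [ab d]]].
- by rewrite -nt.
- by rewrite -e (opT _ _ _ _ hh ab) hx orbT.
case: d => d; first by apply: contraT => /negbTE/d; rewrite hwy.
(* Evaluated on the pullback of [h] by [w], the equation [op y x = y] forces [w * x] into [h],
   whereas [x] and [w * x] cannot both lie there. *)
have := opF _ _ y x (half_shift w hh) (absorbing_shift ab).
by rewrite e hwy /=; case: (d x) => [|->//]; rewrite hx.
Qed.

(** Exchanging [op1] and [op2] gives the mirror equation; by symmetry of the majority the two
    products coincide, which is uniqueness. *)
Lemma quasidirection_absorb op1 op2 a b :
  quasidirection (median S) op1 -> quasidirection (median S) op2 ->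
  (forall x y, op1 y x = y <-> op2 y x = y) ->
  op1 a b = median S a (op2 a b) (op1 a b).
Proof.
move=> [[A1 I1] C1 M1 N1] [[A2 I2] C2 M2 N2] e.
have medE x y : median S x y y = y.
  by apply: (half_eq hGS) => s h hh; rewrite (half_median hGS _ _ _ hh) /maj;
    case: (h x); case: (h y).
set d := op1 a b; set c := op2 a b.
(* The equations on [c] hold for [op2], those on [d] for [op1]; the common preorder transfers them
   to the other operation. *)
have ca : op1 c a = c by apply/e; rewrite /c C2 I2.
have cb : op1 c b = c by apply/e; rewrite /c -A2 I2.
have da : op2 d a = d by apply/e; rewrite /d C1 I1.
have db : op2 d b = d by apply/e; rewrite /d -A1 I1.
have cd : op1 c d = c by rewrite /d A1 ca cb.
have dc : op1 d c = d by apply/e; rewrite /c A2 da db.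
have ad : op1 a d = d by rewrite /d A1 I1.
have ac : op1 a c = d by rewrite -[in LHS]cd A1 C1 ad dc.
have cab : c = median S a c b.
  (* Axiom (iv) at the triple [b], [a], [a], whose median is [a]. *)
  have cE : c = median S b a c by rewrite /c -N2 medE.
  apply: (half_eq hGS) => s h hh; rewrite {1}cE !(half_median hGS _ _ _ hh).
  by rewrite /maj; case: (h a); case: (h b); case: (h c).
by rewrite -{1}ac {1}cab M1 I1.
Qed.

Lemma quasidirection_unique op1 op2 :
  quasidirection (median S) op1 -> quasidirection (median S) op2 ->
  (forall x y, op1 y x = y <-> op2 y x = y) -> op1 = op2.
Proof.
move=> q1 q2 e; apply/funext => a; apply/funext => b.
have e' x y : op2 y x = y <-> op1 y x = y by split=> /e.
rewrite (quasidirection_absorb a b q1 q2 e).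
rewrite [RHS](quasidirection_absorb a b q2 q1 e').
apply: (half_eq hGS) => s h hh; rewrite !(half_median hGS _ _ _ hh) /maj.
by case: (h a); case: (h (op1 a b)); case: (h (op2 a b)).
Qed.

End Direction.

Theorem proposition7p2 (G : groupType) (S : set G) (hGS : raag S) (w : G) :
  exists! op : G -> G -> G,
    quasidirection (median S) op /\
    forall x y : G, preceq S w x y <-> op y x = y.
Proof.
have [op [q pre]] := quasidirection_exists hGS w.
exists op; split=> // op' [q' pre'].
apply: (quasidirection_unique hGS) => // x y.
by split=> [/pre/pre'|/pre'/pre].
Qed.
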